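(* Let $A\in\mathbb{R}^{Nn\times Nn}$ be a symmetric positive definite block tridiagonal matrix with $N$ diagonal blocks of size $n\times n$, let $m\ge 1$ be an integer, and let $\alpha_1,\dots,\alpha_{m-1}\in\mathbb{R}$. Let $a=1$, $b=-1$ and $${}^{\alpha}_{ab}M_m^{-1}=(I+\alpha_1H_{ab}+\dots+\alpha_{m-1}H_{ab}^{m-1})G_{ab}.$$ Then ${}^{\alpha}_{ab}M_m^{-1}A$ has $\frac{N}{2}n$ distinct eigenvalues if $N$ is even, and $\lfloor \frac{N}{2}\rfloor n+1$ distinct eigenvalues if $N$ is odd.
   Context: $N,n\ge 1$ are integers. $A\in\mathbb{R}^{Nn\times Nn}$ is symmetric positive definite and block tridiagonal: its diagonal blocks are $D_1,\dots,D_N\in\mathbb{R}^{n\times n}$, its $(k,k+1)$ block is $O_k\in\mathbb{R}^{n\times n}$ and its $(k+1,k)$ block is $O_k^{\mathrm T}$ for $k=1,\dots,N-1$; all other blocks are zero. Diagonal splitting $A=B_d-C_d$: $B_d=\mathrm{diag}(D_1,\dots,D_N)$ (block diagonal) and $C_d=B_d-A$. Left stair splitting $A=B_l-C_l$: $B_l$ has diagonal blocks $D_1,\dots,D_N$, agrees with $A$ on all even-indexed block rows, and its off-diagonal blocks in odd-indexed block rows are zero; $C_l=B_l-A$. Right stair splitting $A=B_r-C_r$: $B_r$ has diagonal blocks $D_1,\dots,D_N$, agrees with $A$ on all odd-indexed block rows, and its off-diagonal blocks in even-indexed block rows are zero; $C_r=B_r-A$. $B_d,B_l,B_r$ are invertible.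 For real $a,b$ with $2a+b=1$, $$G_{ab}=a(B_l^{-1}+B_r^{-1})+bB_d^{-1},\qquad H_{ab}=a(B_l^{-1}C_l+B_r^{-1}C_r)+bB_d^{-1}C_d.$$ The symbol ${}^{\alpha}_{ab}M_m^{-1}$ is notation for the matrix displayed in the claim.
   Formalization: ''Has K distinct eigenvalues'' is read as ''has at most K for every A, and exactly K for some A, for each N, n, m and α''; exactly K for every A fails, e.g. A = I, N = 2, n = 2 gives only one eigenvalue. *)

(* Defs.v *)
From HB Require Import structures.
From mathcomp Require Import all_boot all_order all_algebra.
From mathcomp Require Import complex.
From mathcomp Require Import classical_sets cardinality reals.

Set Implicit Arguments.
Unset Strict Implicit.
Unset Printing Implicit Defensive.

Import GRing.Theory Num.Theory.
Local Open Scope ring_scope.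

(* N x N block matrices with n x n blocks are indexed by 'I_(\sum_(i < N) n),
   as in the \mxblock theory of matrix.v; \sum_(i < N) n = N * n. *)
Notation "''BM[' R ]_ ( N , n )" := ('M[R]_(\sum_(i < N) n))
  (at level 8, only parsing) : type_scope.

Section StairPreconditioner.
Variables (R : realType) (N n : nat).
Implicit Types (A : 'BM[R]_(N, n)) (a b : R).

Definition block A (i j : 'I_N) : 'M[R]_n :=
  @submxblock R N N (fun=> n) (fun=> n) A i j.

Definition sym_posdef A : Prop :=
  A^T = A /\
  forall x : 'cV[R]_(\sum_(i < N) n), x != 0 -> 0 < (x^T *m A *m x) 0 0.

Definition block_tridiagonal A : Prop :=
  forall i j : 'I_N, (i.+1 < j)%N || (j.+1 < i)%N -> block A i j = 0.

Definition Bd A : 'BM[R]_(N, n) :=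
  \mxblock_(i < N, j < N) (if i == j then block A i j else 0).

(* Block rows are numbered from 0 here and from 1 in the usual description of
   the splittings, so the even-indexed block rows are those with [odd i]. *)
Definition Bl A : 'BM[R]_(N, n) :=
  \mxblock_(i < N, j < N) (if (i == j) || odd i then block A i j else 0).

Definition Br A : 'BM[R]_(N, n) :=
  \mxblock_(i < N, j < N) (if (i == j) || ~~ odd i then block A i j else 0).

Definition Cd A := Bd A - A.
Definition Cl A := Bl A - A.
Definition Cr A := Br A - A.

Definition G a b A : 'BM[R]_(N, n) :=
  a *: (invmx (Bl A) + invmx (Br A)) + b *: invmx (Bd A).

Definition H a b A : 'BM[R]_(N, n) :=
  a *: (invmx (Bl A) *m Cl A + invmx (Br A) *m Cr A)
  + b *: (invmx (Bd A) *m Cd A).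

(* The m-step preconditioner M_m^{-1}; only alpha 1, ..., alpha m.-1 occur. *)
Definition precond a b (m : nat) (alpha : nat -> R) A : 'BM[R]_(N, n) :=
  (1%:M + \sum_(1 <= i < m) alpha i *: H a b A ^+ i) *m G a b A.

End StairPreconditioner.

(* The set of complex eigenvalues of a real square matrix, so that its
   cardinality counts distinct eigenvalues without multiplicity. *)
Definition spectrum (R : realType) (k : nat) (M : 'M[R]_k) : set R[i] :=
  [set z : R[i] | eigenvalue (map_mx (real_complex R) M) z]%classic.

Definition eigen_count (N n : nat) : nat :=
  if odd N then (N./2 * n).+1 else (N./2 * n)%N.

(* Main.v *)
Require Import Defs.
From mathcomp Require Import all_boot all_order all_algebra.
From mathcomp Require Import ring complex.
From mathcomp Require Import classical_sets functions cardinality reals.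

(** Let D be the block diagonal of A and K = D^-1 (A - D).  Group the block
    rows by the parity of their index, counted from 0.  As A is block
    tridiagonal, D couples only rows of equal parity and A - D = L + U only rows
    of opposite parity, where L lives in the odd block rows and U in the even
    ones.  Hence the stair matrices are D + L and D + U with L D^-1 L = U D^-1 U = 0, so that
    (D + L)^-1 = D^-1 - D^-1 L D^-1, and likewise for U.  For a = 1, b = -1
    this gives G = (1 - K) D^-1, hence G A = 1 - K^2 and H = 1 - G A = K^2:
    the preconditioned matrix is W = p(K^2) for the polynomial
    p = (1 + alpha_1 X + ... + alpha_{m-1} X^(m-1)) (1 - X)  ([precond_mulE]).

    Upper bound ([spectrum_precond_le]).  K exchanges the two parity spaces and
    W preserves both.  An eigenvector v of W for mu has two parity components,
    and a nonzero component is again an eigenvector; if one of them vanishes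
    and v K <> 0, then v K is an eigenvector in the other space.  Since
    p(0) = 1, v K = 0 forces mu = 1.  So every mu <> 1 has an eigenvector in
    each parity space, and mu = 1 has one in at least one of them.  The
    restriction of W to a parity space has at most as many eigenvalues as the
    dimension of that space.  For even N both dimensions are (N/2) n, and the
    space that catches mu = 1, if that is an eigenvalue, catches everything; for
    odd N the odd space has dimension floor(N/2) n and mu = 1 counts for one
    more.

    Sharpness.  Couple the blocks 2k and 2k+1 by diagonal blocks and nothing
    else, with identity diagonal blocks: A = 1 + T where T^2 is diagonal with
    entries in [0, 1[, each occurring twice, and a zero block left over when N
    is odd.  Then A is positive definite, K = T, and the eigenvalues of W are the
    values of p at the entries of T^2.  As p(0) = 1 and p(1) = 0, p is not
    constant, so the entries can be chosen with distinct values of p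
    ([separating_points]). *)

Set Implicit Arguments.
Unset Strict Implicit.
Unset Printing Implicit Defensive.

Import Order.TTheory GRing.Theory Num.Theory.
Local Open Scope ring_scope.

(** * Inverses of the stair matrices *)

(** The Neumann series of (d + l)^-1 = (1 + d' l)^-1 d' stops after its second
    term because d' l has square zero. *)
Lemma unipotent_inverse (T : pzRingType) (d d' l : T) :
  d * d' = 1 -> l * d' * l = 0 -> (d + l) * (d' - d' * l * d') = 1.
Proof.
move=> dd' ldl; rewrite mulrDl !mulrBr !mulrA dd' !mul1r ldl mul0r subr0.
by rewrite subrK.
Qed.

Section Splitting.
Variables (F : fieldType) (k : nat) (D L U : 'M[F]_k).
Hypotheses (D_unit : D \in unitmx).
Hypotheses (LDL : L *m invmx D *m L = 0) (UDU : U *m invmx D *m U = 0).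
Let K := invmx D *m (L + U).

Lemma stair_invE (X : 'M[F]_k) : X *m invmx D *m X = 0 ->
  D + X \in unitmx /\ invmx (D + X) = invmx D - invmx D *m X *m invmx D.
Proof.
move=> XDX; have XV := unipotent_inverse (mulmxV D_unit) XDX.
have [uX _] := mulmx1_unit XV; split=> //.
by rewrite -[RHS]mul1mx -(mulVmx uX) -mulmxA [X in _ *m X]XV mulmx1.
Qed.

Lemma combined_invE :
  invmx (D + L) + invmx (D + U) - invmx D = (1 - K) *m invmx D.
Proof.
have [[_ ->] [_ ->]] := (stair_invE LDL, stair_invE UDU).
rewrite mulmxBl mul1mx /K mulmxDr mulmxDl opprD.
by rewrite addrAC [X in X + _]addrAC subrr sub0r addrCA -opprD.
Qed.

Lemma combined_inv_mulE :
  (1 - K) *m invmx D *m (D + L + U) = 1 - K *m K.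
Proof.
rewrite -addrA -mulmxA mulmxDr mulVmx // -/K mulmxDr mulmx1 mulmxBl mul1mx.
by rewrite addrA subrK.
Qed.

(** Each summand B^-1 (B - A) is 1 - B^-1 A, and the coefficients 1, 1, -1 sum
    to 1, so the whole is 1 - G A. *)
Lemma iteration_matE :
  invmx (D + L) *m (D + L - (D + L + U))
  + invmx (D + U) *m (D + U - (D + L + U))
  - invmx D *m (D - (D + L + U)) = K *m K.
Proof.
have [[uL _] [uU _]] := (stair_invE LDL, stair_invE UDU).
rewrite ![_ *m (_ - _)]mulmxBr !mulVmx //.
rewrite -[RHS](subKr 1) -combined_inv_mulE -combined_invE mulmxBl mulmxDl.
set x := invmx _ *m _; set y := invmx _ *m _; set z := invmx _ *m _.
rewrite [- (1 - z)]opprB [- (x + y - z)]opprD opprK opprD [z - 1]addrC addrA.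
by rewrite -[X in X + z]addrA [1 - y - 1]addrAC subrr sub0r !addrA.
Qed.

End Splitting.

(** * Parity of block rows *)

Section Parity.
Variables (F : fieldType) (N n : nat).
Implicit Types (e : bool) (A : 'M[F]_(\sum_(i < N) n)).

(** Orthogonal projector onto the block rows whose index, counted from 0, has
    parity e. *)
Definition parity_mx e : 'M[F]_(\sum_(i < N) n) :=
  diag_mx (\row_s (odd (tagnat.sig1 s) == e)%:R).

Lemma parity_mxD e : parity_mx e + parity_mx (~~ e) = 1.
Proof.
apply/matrixP => s t; rewrite !mxE -mulrnDl; congr (_ *+ _).
by case: e; case: odd; rewrite ?addr0 ?add0r.
Qed.

Lemma parity_mxM e e' :
  parity_mx e *m parity_mx e' = if e == e' then parity_mx e else 0.
Proof.
apply/matrixP => s t; rewrite /parity_mx mul_diag_mx !mxE.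
by case: e; case: e'; rewrite !mxE; case: (s =P t) => [->|_]; case: odd;
  rewrite /= ?(mulr0n, mulr1n, mulr0, mul0r, mulr1, mul1r).
Qed.

Lemma parity_mulE e e' A s t :
  (parity_mx e *m A *m parity_mx e') s t =
  if (odd (tagnat.sig1 s) == e) && (odd (tagnat.sig1 t) == e') then A s t else 0.
Proof.
rewrite /parity_mx mul_mx_diag mxE mul_diag_mx !mxE.
by do 2!case: eqP => _; rewrite /= ?(mulr0, mul0r, mulr1, mul1r).
Qed.

Lemma mxrank_parity e :
  \rank (parity_mx e) = (\sum_(i < N | odd i == e) n)%N.
Proof.
have -> : parity_mx e = \mxdiag_(i < N) ((odd i == e)%:R)%:M.
  apply/mxblockP => i j; rewrite mxblockK; apply/matrixP => k l.
  rewrite !mxE tagnat.Rank1K -val_eqE tagnat.eq_Rank /=.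
  case: (i == j); last by rewrite mulr0n mxE.
  by rewrite /= conform_mx_id !mxE val_eqE.
rewrite rank_mxdiag [RHS]big_mkcond; apply: eq_bigr => i _.
by case: (_ == e); rewrite ?mxrank1 // -scalemx1 scale0r mxrank0.
Qed.

Lemma mxrank_parity_odd : \rank (parity_mx true) = (N./2 * n)%N.
Proof.
rewrite mxrank_parity sum_nat_const; congr (_ * _)%N.
rewrite -sum1_card big_mkcond /=.
elim: N => [|M IH]; first by rewrite big_ord0.
rewrite big_ord_recr /= IH unfold_in /= uphalf_half.
by case: (boolP (odd M)); rewrite //= ?addn0 // addnC.
Qed.

Lemma mxrank_parity_even : ~~ odd N -> \rank (parity_mx false) = (N./2 * n)%N.
Proof.
rewrite mxrank_parity sum_nat_const; move=> oN; congr (_ * _)%N.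
suff -> : #|[pred i : 'I_N | odd i == false]| = uphalf N.
  by rewrite uphalf_half (negbTE oN).
rewrite -sum1_card big_mkcond /= {oN}.
elim: N => [|M IH]; first by rewrite big_ord0.
rewrite big_ord_recr /= IH unfold_in /= uphalf_half.
by case: (boolP (odd M)); rewrite /= ?addn0 ?add0n ?addn1.
Qed.

End Parity.

(** * The polynomial of the m-step method *)

Section PolynomialInK.
Variables (F : fieldType) (k m : nat) (alpha : nat -> F).
Implicit Types (K Z X : 'M[F]_k).

Definition step_poly : {poly F} :=
  (1 + \sum_(1 <= i < m) alpha i *: 'X^i) * (1 - 'X).

Definition step_mx Z : 'M[F]_k :=
  (1 + \sum_(1 <= i < m) alpha i *: Z ^+ i) *m (1 - Z).

Lemma step_poly0 : step_poly.[0] = 1.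
Proof.
rewrite /step_poly !hornerE horner_sum big_nat_cond big1 ?addr0 ?mul1r ?subr0 //.
by move=> i /andP[/andP[i_gt0 _] _]; rewrite !hornerE expr0n gtn_eqF // mulr0.
Qed.

Lemma step_poly1 : step_poly.[1] = 0.
Proof. by rewrite /step_poly !hornerE subrr mulr0. Qed.

Lemma comm_step_mx X Z : comm_mx X Z -> comm_mx X (step_mx Z).
Proof.
move=> XZ; apply: comm_mxM; last by apply: comm_mxB => //; apply: comm_mx1.
apply: comm_mxD; first exact: comm_mx1.
apply: comm_mx_sum => i _; rewrite -mul_scalar_mx.
apply: comm_mxM; first exact: comm_mx_scalar.
exact: (@GRing.commrX _ _ _ i XZ).
Qed.

Lemma step_mx_eigenvector Z t (v : 'rV[F]_k) :
  v *m Z = t *: v -> v *m step_mx Z = step_poly.[t] *: v.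
Proof.
move=> vZ.
have vZi i : v *m Z ^+ i = t ^+ i *: v.
  elim: i => [|i IH]; first by rewrite !expr0 scale1r mulmx1.
  by rewrite exprSr mulmxA IH -scalemxAl vZ scalerA exprSr.
rewrite /step_mx mulmxA [v *m (1 + _)]mulmxDr mulmx1 mulmx_sumr.
under eq_bigr do rewrite -scalemxAr vZi scalerA.
rewrite -scaler_suml -[X in X + _]scale1r -scalerDl -scalemxAl.
rewrite mulmxBr mulmx1 vZ -[X in X - _]scale1r -scalerBl scalerA.
rewrite /step_poly !hornerE horner_sum; congr ((1 + _) * _ *: _).
by apply: eq_bigr => i _; rewrite !hornerE.
Qed.

(** Since step_poly takes the value 1 at 0, the row kernel of K is fixed by
    step_mx (K *m K); this factored form of the fact survives a change of the
    ground field. *)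
Lemma step_mx_factor K : exists Y, step_mx (K *m K) = 1 + K *m Y.
Proof.
pose Y := \sum_(1 <= i < m) alpha i *: (K *m K) ^+ i.-1.
have -> : step_mx (K *m K) = (1 + K *m K *m Y) *m (1 - K *m K).
  congr ((1 + _) *m _); rewrite mulmx_sumr; apply: eq_big_nat => i /andP[i_gt0 _].
  by rewrite -scalemxAr; congr (_ *: _); case: i i_gt0 => // i _; rewrite exprS.
exists (K *m (Y *m (1 - K *m K) - 1)).
rewrite mulmxDl mul1mx [K *m (K *m _)]mulmxA [K *m K *m (_ - 1)]mulmxBr.
by rewrite [_ *m 1]mulmx1 [in RHS]mulmxA -addrA [- _ + _]addrC.
Qed.

End PolynomialInK.

(** * The preconditioned matrix as a polynomial *)

Section Preconditioner.
Variables (R : realType) (N n : nat).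
Implicit Types (A : 'BM[R]_(N, n)) (e : bool).
Local Notation P := (@parity_mx R N n).

Lemma block_entry A s t :
  block A (tagnat.sig1 s) (tagnat.sig1 t) (tagnat.sig2 s) (tagnat.sig2 t)
  = A s t.
Proof. by rewrite mxE !tagnat.sig2K. Qed.

(** Distinct block indices of equal parity are at distance at least 2. *)
Lemma block_tridiagonal_entry A s t : block_tridiagonal A ->
  odd (tagnat.sig1 s) = odd (tagnat.sig1 t) -> tagnat.sig1 s != tagnat.sig1 t ->
  A s t = 0.
Proof.
move=> triA eq_odd neq; rewrite -block_entry triA ?mxE //.
move: neq; rewrite -val_eqE /= neq_ltn => /orP[] lt; apply/orP; [left | right];
  rewrite ltn_neqAle lt andbT; apply/eqP => eq; move: eq_odd; rewrite -eq /=;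
  by case: odd.
Qed.

Section Tridiagonal.
Variables (A : 'BM[R]_(N, n)) (triA : block_tridiagonal A).

Lemma BdE : Bd A = P true *m A *m P true + P false *m A *m P false.
Proof.
apply/matrixP => s t; rewrite [RHS]mxE !parity_mulE mxE.
rewrite (fun_if (fun M : 'M_n => M _ _)) block_entry mxE.
have := @block_tridiagonal_entry A s t triA.
case: (tagnat.sig1 s =P tagnat.sig1 t) => [-> _|_].
  by case: odd; rewrite /= ?addr0 ?add0r.
by (do 2!case: odd) => /= Ast; rewrite ?addr0 ?add0r // Ast.
Qed.

Lemma BlE : Bl A = Bd A + P true *m A *m P false.
Proof.
apply/matrixP => s t; rewrite [RHS]mxE parity_mulE !mxE.
rewrite !(fun_if (fun M : 'M_n => M _ _)) block_entry mxE.
have := @block_tridiagonal_entry A s t triA.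
case: (tagnat.sig1 s =P tagnat.sig1 t) => [-> _|_] /=.
  by case: odd; rewrite /= ?addr0.
by (do 2!case: odd) => /= Ast; rewrite ?addr0 ?add0r // Ast.
Qed.

Lemma BrE : Br A = Bd A + P false *m A *m P true.
Proof.
apply/matrixP => s t; rewrite [RHS]mxE parity_mulE !mxE.
rewrite !(fun_if (fun M : 'M_n => M _ _)) block_entry mxE.
have := @block_tridiagonal_entry A s t triA.
case: (tagnat.sig1 s =P tagnat.sig1 t) => [-> _|_] /=.
  by case: odd; rewrite /= ?addr0.
by (do 2!case: odd) => /= Ast; rewrite ?addr0 ?add0r // Ast.
Qed.

Lemma parity_splitting :
  A = Bd A + P true *m A *m P false + P false *m A *m P true.
Proof.
have e1 : 1%:M = P true + P false by rewrite (parity_mxD R N n true).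
rewrite BdE -[LHS]mul1mx -[LHS]mulmx1 e1 mulmxDl mulmxDr !mulmxDl.
by rewrite [X in _ + X]addrC addrACA [X in _ + X]addrC addrA.
Qed.

Lemma sub_BdE :
  A - Bd A = P true *m A *m P false + P false *m A *m P true.
Proof.
rewrite [X in X - _]parity_splitting -[X in X - _]addrA addrAC.
by rewrite subrr add0r.
Qed.

Lemma Bd_parity e : P e *m Bd A = Bd A *m P e.
Proof.
rewrite BdE mulmxDr mulmxDl !mulmxA !parity_mxM -!mulmxA !parity_mxM.
by case: e; rewrite /= ?mul0mx ?mulmx0 ?mulmxA.
Qed.
End Tridiagonal.

Lemma posdef_unitmx k (X : 'M[R]_k) :
  (forall x : 'cV[R]_k, x != 0 -> 0 < (x^T *m X *m x) 0 0) -> X \in unitmx.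
Proof.
move=> posX; rewrite -row_free_unit; apply: inj_row_free => v vX.
apply/eqP/negPn/negP => v_neq0; have := posX v^T.
by rewrite trmx_eq0 trmxK vX mul0mx mxE ltxx => /(_ v_neq0).
Qed.

(** Bd A is the sum of the compressions of A to the two parity spaces, so its
    quadratic form at x is that of A at the two components of x, added up. *)
Lemma Bd_unitmx A : sym_posdef A -> block_tridiagonal A -> Bd A \in unitmx.
Proof.
move=> [_ posA] triA; apply: posdef_unitmx => x x_neq0.
have trP e : (P e)^T = P e by rewrite tr_diag_mx.
have quadE e : x^T *m (P e *m A *m P e) *m x = (P e *m x)^T *m A *m (P e *m x).
  by rewrite trmx_mul trP !mulmxA.
have quad_ge0 e : 0 <= (x^T *m (P e *m A *m P e) *m x) 0 0.
  rewrite quadE; have [->|/posA /ltW //] := eqVneq (P e *m x) 0.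
  by rewrite mulmx0 mxE.
rewrite BdE // mulmxDr mulmxDl mxE lt_neqAle addr_ge0 // andbT eq_sym.
rewrite paddr_eq0 // negb_and.
have : (P true *m x != 0) || (P false *m x != 0).
  apply: contraNT x_neq0; rewrite negb_or !negbK => /andP[/eqP Pt /eqP Pf].
  by rewrite -[x]mul1mx idmxE -(parity_mxD _ _ _ true) mulmxDl Pt Pf addr0.
by case/orP => /posA; rewrite -quadE => /lt0r_neq0 ->; rewrite ?orbT.
Qed.

(** The negative of the block Jacobi iteration matrix. *)
Definition scaled_offdiag A := invmx (Bd A) *m (A - Bd A).

Section Factorisation.
Variables (A : 'BM[R]_(N, n)).
Hypotheses (pdA : sym_posdef A) (triA : block_tridiagonal A).
Let K := scaled_offdiag A.

Lemma invmx_Bd_parity e : P e *m invmx (Bd A) = invmx (Bd A) *m P e.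
Proof.
have uD := Bd_unitmx pdA triA.
by rewrite -[LHS](mulKmx uD) [Bd A *m (_ *m _)]mulmxA -Bd_parity // mulmxK.
Qed.

Lemma scaled_offdiag_parity e : P e *m K = K *m P (~~ e).
Proof.
rewrite /K /scaled_offdiag mulmxA invmx_Bd_parity -!mulmxA; congr (_ *m _).
rewrite sub_BdE //.
rewrite mulmxDr mulmxDl !mulmxA !parity_mxM -!mulmxA !parity_mxM.
by case: e; rewrite /= ?mul0mx ?mulmx0 ?addr0 ?add0r ?mulmxA.
Qed.

Lemma precond_mulE m alpha :
  precond 1 (-1) m alpha A *m A =
  step_mx m alpha (K *m K).
Proof.
have uD := Bd_unitmx pdA triA.
(* D^-1 preserves parity, so P (~~ e) and P e meet and cancel *)
have nil e : (P e *m A *m P (~~ e)) *m invmx (Bd A)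
             *m (P e *m A *m P (~~ e)) = 0.
  rewrite -!mulmxA [P (~~ e) *m (invmx _ *m _)]mulmxA invmx_Bd_parity.
  rewrite -!mulmxA [P (~~ e) *m (P e *m _)]mulmxA parity_mxM.
  by case: e => /=; rewrite !(mul0mx, mulmx0).
have [nilL nilU] := (nil true, nil false); move: nilL nilU => /= nilL nilU.
have KE : K = invmx (Bd A)
              *m (P true *m A *m P false + P false *m A *m P true).
  by rewrite /K /scaled_offdiag sub_BdE.
have GE : G 1 (-1) A = (1 - K) *m invmx (Bd A).
  rewrite KE -combined_invE // /G scale1r scaleN1r BlE // BrE //.
have GAE : G 1 (-1) A *m A = 1 - K *m K.
  by rewrite GE KE -combined_inv_mulE // -parity_splitting.
have HE : H 1 (-1) A = K *m K.
  rewrite KE -iteration_matE // -parity_splitting // /H scale1r scaleN1r.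
  by rewrite /Cd /Cl /Cr BlE // BrE.
by rewrite /precond HE -[LHS]mulmxA GAE.
Qed.

End Factorisation.
End Preconditioner.

(** * Eigenvectors and parity *)

(** The list consists of the roots, with multiplicity, of the characteristic
    polynomial of W restricted to the row space of P, which W preserves. *)
Lemma eigenvalues_on_projector (C : closedFieldType) k (P W : 'M[C]_k) :
    P *m W = W *m P ->
  exists2 s : seq C, size s = \rank P &
    forall (mu : C) (v : 'rV_k), v != 0 -> v *m P = v -> v *m W = mu *: v ->
      mu \in s.
Proof.
move=> PW; pose V := row_base P.
have stV : stablemx V W by rewrite stablemx_row_base PW submxMl.
have frV : row_free V := row_base_free P.
have [s] := closed_field_poly_normal (char_poly (conjmx V W)).
rewrite (monicP (char_poly_monic _)) scale1r => charE.
exists s => [|mu v v_neq0 vP vW].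
  apply: succn_inj; rewrite -(size_char_poly (conjmx V W)) charE.
  by rewrite size_prod_XsubC.
have /submxP[u uV] : (v <= V)%MS by rewrite eq_row_base -vP submxMl.
rewrite -root_prod_XsubC -charE -eigenvalue_root_char.
apply/eigenvalueP; exists u; last first.
  by apply: contraNneq v_neq0 => u0; rewrite uV u0 mul0mx.
by apply/eigenspaceP; rewrite sub_eigenspace_conjmx // -uV; apply/eigenspaceP.
Qed.

Section BipartiteEigenvectors.
Variables (F : fieldType) (k : nat) (P : bool -> 'M[F]_k) (K Y W : 'M[F]_k).
Hypotheses (WE : W = 1 + K *m Y) (KW : K *m W = W *m K).
Hypotheses (PD : forall e, P e + P (~~ e) = 1) (PP : forall e, P e *m P e = P e).
Hypotheses (PK : forall e, P e *m K = K *m P (~~ e)).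
Hypotheses (PW : forall e, P e *m W = W *m P e).

Lemma eigenvector_on_projection (mu : F) (v : 'rV_k) e :
  v *m W = mu *: v ->
  v *m P e *m P e = v *m P e /\ v *m P e *m W = mu *: (v *m P e).
Proof. by move=> vW; rewrite -!mulmxA PP PW mulmxA vW scalemxAl. Qed.

Lemma eigenvector_some_parity (mu : F) (v : 'rV_k) :
  v != 0 -> v *m W = mu *: v ->
  exists e (w : 'rV_k), [/\ w != 0, w *m P e = w & w *m W = mu *: w].
Proof.
move=> v_neq0 vW.
have [vP | vP] := eqVneq (v *m P true) 0; last first.
  by exists true, (v *m P true); have [] := eigenvector_on_projection true vW.
exists false, v; split=> //.
by rewrite -[RHS]mulmx1 idmxE -(PD true) mulmxDr vP add0r.
Qed.

(** If v has no component in P e, multiplication by K moves it there; this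
    fails only when v K = 0, and then v W = v. *)
Lemma eigenvector_each_parity (mu : F) (v : 'rV_k) e :
  mu != 1 -> v != 0 -> v *m W = mu *: v ->
  exists w : 'rV_k, [/\ w != 0, w *m P e = w & w *m W = mu *: w].
Proof.
move=> mu_neq1 v_neq0 vW.
have [vP | vP] := eqVneq (v *m P e) 0; last first.
  by exists (v *m P e); have [] := eigenvector_on_projection e vW.
have vPn : v *m P (~~ e) = v.
  by rewrite -[RHS]mulmx1 idmxE -(PD e) mulmxDr vP add0r.
exists (v *m K); split; last 2 first.
- by rewrite -mulmxA -[e in P e]negbK -PK mulmxA vPn.
- by rewrite -mulmxA KW mulmxA vW scalemxAl.
apply: contraNneq mu_neq1 => vK.
move: vW; rewrite WE mulmxDr mulmx1 mulmxA vK mul0mx addr0 => /esym/eqP.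
rewrite -subr_eq0 -{2}[v]scale1r -scalerBl scaler_eq0 (negbTE v_neq0) orbF.
by rewrite subr_eq0.
Qed.

End BipartiteEigenvectors.

(** * Upper bound on the number of eigenvalues *)

Lemma card_le_seq (T : eqType) (S : set T) (s : seq T) :
  (forall x, S x -> x \in s) -> (S #<= `I_(size s))%card.
Proof.
move=> Ss; suff /injfunPex[f] : exists2 f : T -> nat,
    set_fun S (`I_(size s)) f & set_inj S f by apply: inj_card_le.
exists (index^~ s) => [x Sx|x y]; first by rewrite /= index_mem Ss.
rewrite !inE => Sx Sy eq_index.
by rewrite -(nth_index x (Ss x Sx)) -(nth_index x (Ss y Sy)) eq_index.
Qed.

Section UpperBound.
Variables (R : realType) (N n m : nat) (alpha : nat -> R) (A : 'BM[R]_(N, n)).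
Hypotheses (pdA : sym_posdef A) (triA : block_tridiagonal A).

Lemma spectrum_precond_le :
  (spectrum (precond 1 (-1) m alpha A *m A) #<= `I_(eigen_count N n))%card.
Proof.
rewrite precond_mulE //; set K := scaled_offdiag A; set W0 := step_mx _ _ _.
pose f := real_complex R; pose W := map_mx f W0.
pose P e := map_mx f (parity_mx R N n e).
have [Y0 W0E] := step_mx_factor m alpha K.
have WE : W = 1 + map_mx f K *m map_mx f Y0.
  by rewrite /W /W0 W0E map_mxD map_mx1 map_mxM.
have KW : map_mx f K *m W = W *m map_mx f K.
  rewrite -!map_mxM (comm_step_mx m alpha (_ : comm_mx K (K *m K))) //.
  by rewrite /comm_mx mulmxA.
have PK e : P e *m map_mx f K = map_mx f K *m P (~~ e).
  by rewrite -!map_mxM scaled_offdiag_parity.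
have PW e : P e *m W = W *m P e.
  rewrite -!map_mxM; congr map_mx; apply: comm_step_mx; rewrite /comm_mx.
  rewrite mulmxA scaled_offdiag_parity // -mulmxA scaled_offdiag_parity //.
  by rewrite negbK mulmxA.
have PD e : P e + P (~~ e) = 1 by rewrite -map_mxD parity_mxD map_mx1.
have PP e : P e *m P e = P e by rewrite -map_mxM parity_mxM eqxx.
have [st size_st inst] := eigenvalues_on_projector (PW true).
have [sf size_sf insf] := eigenvalues_on_projector (PW false).
have specE mu : spectrum W0 mu ->
    exists2 v : 'rV_(\sum_(i < N) n), v *m W = mu *: v & v != 0.
  by move=> Smu; apply/eigenvalueP.
have spec_neq1 mu : spectrum W0 mu -> mu != 1 -> mu \in st /\ mu \in sf.
  move=> /specE[v vW v_neq0] mu_neq1.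
  have flip e := eigenvector_each_parity WE KW PD PP PK PW e mu_neq1 v_neq0 vW.
  have [[w [w0 wP wW]] [w' [w'0 w'P w'W]]] := (flip true, flip false).
  by split; [apply: inst w0 wP wW | apply: insf w'0 w'P w'W].
have spec1 : spectrum W0 1 -> 1 \in st \/ 1 \in sf.
  move=> /specE[v vW v_neq0].
  have [[] [w [w0 wP wW]]] := eigenvector_some_parity PD PP PW v_neq0 vW.
    by left; apply: inst w0 wP wW.
  by right; apply: insf w0 wP wW.
rewrite mxrank_map mxrank_parity_odd in size_st.
rewrite /eigen_count; case: (boolP (odd N)) => oN.
  rewrite -size_st -[(size st).+1]/(size (1 :: st)); apply: card_le_seq => mu Smu.
  rewrite inE; have [//|mu_neq1] := eqVneq mu 1.
  by have [->] := spec_neq1 mu Smu mu_neq1.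
rewrite mxrank_map mxrank_parity_even // in size_sf.
(* one of the two lists contains 1 if 1 is an eigenvalue, hence everything *)
have [in1|notin1] := boolP (1 \in st).
  rewrite -size_st; apply: card_le_seq => mu Smu.
  by have [-> //|/(spec_neq1 _ Smu)[]] := eqVneq mu 1.
rewrite -size_sf; apply: card_le_seq => mu Smu.
have [mu1|/(spec_neq1 _ Smu)[]//] := eqVneq mu 1.
by rewrite mu1 in Smu *; have [] := spec1 Smu; first by rewrite (negbTE notin1).
Qed.

End UpperBound.

(** * Points with distinct polynomial values *)

Section SeparatingPoints.
Variables (R : realFieldType).
Implicit Types (p q : {poly R}).

Lemma exists_nonroot q : q != 0 -> exists x : R, 0 <= x < 1 /\ q.[x] != 0.
Proof.
move=> q_neq0; pose pts := [seq (i.+2%:R : R)^-1 | i <- iota 0 (size q)].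
have uniq_pts : uniq pts.
  rewrite map_inj_uniq ?iota_uniq // => i j /invr_inj/eqP.
  by rewrite eqr_nat eqSS eqSS => /eqP.
have /allPn[x] : ~~ all (root q) pts.
  apply/negP => /(max_poly_roots q_neq0)/(_ uniq_pts).
  by rewrite size_map size_iota ltnn.
case/mapP => i _ -> rootN; exists (i.+2%:R)^-1; split=> //.
by rewrite invr_ge0 ler0n invf_lt1 ?ltr0n // ltr1n.
Qed.

(** Greedy choice: the points at which p takes one of finitely many values
    already used are the roots of a nonzero polynomial. *)
Lemma separating_points p (k : nat) : p.[0] != p.[1] ->
  exists u : nat -> R, [/\ u 0%N = 0, forall i, 0 <= u i < 1 &
    forall i j, (i <= k)%N -> (j <= k)%N -> p.[u i] = p.[u j] -> i = j].
Proof.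
move=> p01; suff [s [size_s s0 s_itv uniq_s]] : exists s : seq R,
    [/\ size s = k.+1, s`_0 = 0, all (fun x => 0 <= x < 1) s
      & uniq [seq p.[x] | x <- s]].
  exists (nth 0 s); split=> // [i|i j le_ik le_jk eq_p].
    have [lt_is|le_si] := ltnP i (size s); first by rewrite (all_nthP 0 s_itv).
    by rewrite nth_default // lexx ltr01.
  apply/eqP; rewrite -(nth_uniq p.[0] _ _ uniq_s) ?size_map ?size_s ?ltnS //.
  by rewrite !(nth_map 0) ?size_s ?ltnS // eq_p.
elim: k => [|k [s [size_s s0 s_itv uniq_s]]].
  by exists [:: 0]; rewrite /= lexx ltr01.
have q_neq0 : \prod_(x <- s) (p - p.[x]%:P) != 0.
  rewrite prodf_seq_neq0; apply/allP => x _; rewrite implyTb subr_eq0.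
  by apply: contraNneq p01 => ->; rewrite !hornerC.
have [y [y_itv]] := exists_nonroot q_neq0.
rewrite horner_prod prodf_seq_neq0 => /allP p_new.
exists (rcons s y); split.
- by rewrite size_rcons size_s.
- by rewrite nth_rcons size_s.
- by rewrite all_rcons y_itv.
rewrite map_rcons rcons_uniq uniq_s andbT; apply/mapP => -[x s_x eq_p].
by have := p_new x s_x; rewrite !hornerE eq_p subrr eqxx.
Qed.

End SeparatingPoints.

(** * Block matrices with many eigenvalues *)

Section PairedBlocks.
Variables (R : realType) (N n : nat) (u : nat -> R).
Hypotheses (u0 : u 0%N = 0) (u_itv : forall i, 0 <= u i < 1).
Local Notation idx := 'I_(\sum_(i < N) n).
Implicit Types (i : 'I_N) (s t : idx).

(** Exchanges 2k and 2k+1.  When N is odd, the last index N - 1 has no successor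
    and insubd leaves it fixed. *)
Definition partner i : 'I_N := insubd i (if odd i then i.-1 else i.+1).

Lemma partnerE i :
  partner i = (if odd i then i.-1 else if (i.+1 < N)%N then i.+1 else i) :> nat.
Proof.
rewrite /partner val_insubd; case: (odd i) => //.
by rewrite (leq_ltn_trans (leq_pred i)).
Qed.

Lemma partnerK : involutive partner.
Proof.
move=> i; apply/val_inj; rewrite /= !partnerE.
have := ltn_ord i; case: (nat_of_ord i) => [|k] /=.
  by case: (ltnP 1 N) => [|le_N] /=; rewrite ?[(1 < N)%N]ltnNge ?le_N.
case: (boolP (odd k)) => ok /=; rewrite ?ok /=.
  by case: (ltnP k.+2 N) => /= [_ _|le_N _]; rewrite ?ok //= ltnNge le_N.
by move=> ->; rewrite (negbTE ok).
Qed.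

Lemma partner_half i : (partner i)./2 = i./2.
Proof.
rewrite partnerE; case: (boolP (odd i)) => oi.
  by case: (nat_of_ord i) oi => //= k; rewrite uphalf_half => /negbTE ->.
by case: ifP => _ //=; rewrite uphalf_half (negbTE oi).
Qed.

Definition mate s : idx :=
  @tagnat.Rank N (fun=> n) (partner (tagnat.sig1 s)) (tagnat.sig2 s).

Lemma val_sig2_Rank i (j : 'I_n) :
  tagnat.sig2 (@tagnat.Rank N (fun=> n) i j) = j :> nat.
Proof. by rewrite tagnat.Rank2K. Qed.

Lemma mateK : involutive mate.
Proof.
move=> s; apply/val_inj/eqP; rewrite /mate -[X in _ == val X]tagnat.sig2K.
by rewrite tagnat.eq_Rank tagnat.Rank1K partnerK val_sig2_Rank !eqxx.
Qed.

(** Numbers the pairs {s, mate s} from 1 on; 0 is the label of the unpaired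
    indices, so that u 0 = 0 removes the coupling there. *)
Definition pair_label s : nat :=
  if partner (tagnat.sig1 s) == tagnat.sig1 s then 0%N
  else ((tagnat.sig1 s)./2 * n + tagnat.sig2 s).+1.

Lemma pair_label_mate s : pair_label (mate s) = pair_label s.
Proof.
by rewrite /pair_label val_sig2_Rank tagnat.Rank1K partner_half partnerK eq_sym.
Qed.

Definition coupling s : R := Num.sqrt (u (pair_label s)).

Definition coupling_mx : 'BM[R]_(N, n) :=
  \matrix_(s, t) (coupling s *+ (mate s == t)).

Definition paired_mx : 'BM[R]_(N, n) := 1 + coupling_mx.

Lemma coupling_mate s : coupling (mate s) = coupling s.
Proof. by rewrite /coupling pair_label_mate. Qed.

Lemma coupling_ge0 s : 0 <= coupling s. Proof. exact: sqrtr_ge0. Qed.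

Lemma coupling_lt1 s : coupling s < 1.
Proof.
by rewrite -[ltRHS]sqrtr1 ltr_sqrt ?ltr01 //; case/andP: (u_itv (pair_label s)).
Qed.

Lemma coupling_diag s t : tagnat.sig1 s = tagnat.sig1 t -> coupling_mx s t = 0.
Proof.
move=> eq_st; rewrite mxE; case: (mate s =P t) => // mate_s.
have fixed : partner (tagnat.sig1 s) == tagnat.sig1 s.
  by rewrite [eqbRHS]eq_st -mate_s tagnat.Rank1K.
by rewrite /coupling /pair_label fixed u0 sqrtr0.
Qed.

Lemma paired_mx_tridiagonal : block_tridiagonal paired_mx.
Proof.
move=> i j far; apply/matrixP => k l; rewrite !mxE.
rewrite -!val_eqE /mate /= !tagnat.eq_Rank tagnat.Rank1K /=.
have -> : (i == j) = false.
  by apply: contraTF far => /eqP ->; rewrite ltnNge leqnSn.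
have -> : (partner i == j) = false; last by rewrite /= !mulr0n addr0.
apply: contraTF far => /eqP <-; rewrite partnerE negb_or -!leqNgt.
case: (odd i); first by rewrite leqSpred (leq_trans (leq_pred i)) ?leqnSn.
by case: ifP => _; rewrite ?leqnn ?leqnSn // leqW.
Qed.

(** Symmetrizing the quadratic form under s <-> mate s turns it into half a sum
    of the nonnegative terms (1 - c) (x^2 + y^2) + c (x + y)^2 with 0 <= c < 1. *)
Lemma paired_mx_posdef : sym_posdef paired_mx.
Proof.
split.
  apply/matrixP => s t; rewrite !mxE eq_sym; congr (_ + _).
  rewrite (can2_eq mateK mateK) [t == _]eq_sym; case: (mate s =P t) => // <-.
  by rewrite coupling_mate.
move=> x x_neq0; rewrite -mulmxA.
have rowE s : (paired_mx *m x) s 0 = x s 0 + coupling s * x (mate s) 0.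
  rewrite mulmxDl mul1mx mxE; congr (_ + _); rewrite mxE (bigD1 (mate s)) //=.
  rewrite mxE eqxx mulr1n [X in _ + X]big1 ?addr0 // => t /negbTE t_neq.
  by rewrite mxE eq_sym t_neq mul0r.
have quadE : ((x^T *m (paired_mx *m x)) 0 0) *+ 2 =
    \sum_s ((1 - coupling s) * (x s 0 ^+ 2 + x (mate s) 0 ^+ 2)
            + coupling s * (x s 0 + x (mate s) 0) ^+ 2).
  have -> : (x^T *m (paired_mx *m x)) 0 0 =
      \sum_s x s 0 * (x s 0 + coupling s * x (mate s) 0).
    by rewrite mxE; apply: eq_bigr => s _; rewrite [x^T _ _]mxE rowE.
  rewrite mulr2n [X in _ + X](reindex_inj (inv_inj mateK)) -big_split /=.
  by apply: eq_bigr => s _; rewrite coupling_mate mateK; ring.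
have term_ge0 s : 0 <= (1 - coupling s) * (x s 0 ^+ 2 + x (mate s) 0 ^+ 2)
            + coupling s * (x s 0 + x (mate s) 0) ^+ 2.
  have := coupling_ge0 s; have /ltW := coupling_lt1 s => c1 c0.
  by rewrite addr_ge0 // mulr_ge0 ?subr_ge0 // ?addr_ge0 ?sqr_ge0.
have [s xs] : exists s, x s 0 != 0.
  apply/existsP; apply: contraNT x_neq0 => /existsPn x0.
  by apply/eqP/matrixP => s j; rewrite ord1 mxE; apply/eqP/negPn.
rewrite -(pmulrn_lgt0 _ (ltn0Sn 1)) quadE (bigD1 s) //=.
apply: ltr_wpDr; first by apply: sumr_ge0.
apply: ltr_wpDr; first by rewrite mulr_ge0 ?coupling_ge0 ?sqr_ge0.
rewrite mulr_gt0 ?subr_gt0 ?coupling_lt1 //.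
by apply: ltr_wpDr; rewrite ?sqr_ge0 // lt0r sqr_ge0 expf_neq0.
Qed.

Lemma Bd_paired_mx : Bd paired_mx = 1.
Proof.
apply/matrixP => s t; rewrite mxE.
rewrite (fun_if (fun M : 'M_n => M _ _)) block_entry [RHS]mxE mxE.
rewrite [in LHS]mxE [(0 : 'M_n) _ _]mxE.
have [eq_st|] := eqVneq (tagnat.sig1 s) (tagnat.sig1 t).
  by rewrite coupling_diag // addr0.
by case: (s =P t) => [->|_]; rewrite ?eqxx.
Qed.

Lemma scaled_offdiag_paired_mx : scaled_offdiag paired_mx = coupling_mx.
Proof.
rewrite /scaled_offdiag Bd_paired_mx invmx1 mul1mx.
by rewrite /paired_mx addrAC subrr add0r.
Qed.

Lemma coupling_mx_sqr s :
  delta_mx 0 s *m (coupling_mx *m coupling_mx)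
  = u (pair_label s) *: delta_mx 0 s :> 'rV_(_).
Proof.
have rowT t : delta_mx 0 t *m coupling_mx
              = coupling t *: delta_mx 0 (mate t) :> 'rV_(_).
  rewrite -rowE; apply/rowP => j; rewrite !mxE eqxx eq_sym /=.
  by case: (_ == _); rewrite ?mulr1 ?mulr0.
rewrite mulmxA rowT -scalemxAl rowT scalerA coupling_mate mateK -expr2.
by rewrite sqr_sqrtr //; case/andP: (u_itv (pair_label s)).
Qed.

Lemma spectrum_paired_mx m alpha s :
  spectrum (precond 1 (-1) m alpha paired_mx *m paired_mx)
    (real_complex R (step_poly m alpha).[u (pair_label s)]).
Proof.
rewrite precond_mulE; [|exact: paired_mx_posdef|exact: paired_mx_tridiagonal].
rewrite /spectrum /= eigenvalue_map scaled_offdiag_paired_mx.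
apply/eigenvalueP; exists (delta_mx 0 s).
  exact: step_mx_eigenvector (coupling_mx_sqr s).
by apply/eqP => /matrixP/(_ 0 s)/eqP; rewrite !mxE !eqxx oner_eq0.
Qed.

Lemma pair_label_onto k : (k < N./2 * n)%N -> exists s, pair_label s = k.+1.
Proof.
move=> lt_k; have n_gt0 : (0 < n)%N by case: (n) lt_k; rewrite ?muln0.
have lt_q : (k %/ n < N./2)%N by rewrite ltn_divLR.
have lt_i : ((k %/ n).*2.+1 < N)%N.
  rewrite -[N]odd_double_half -doubleS.
  by rewrite (leq_trans (_ : _ <= (N./2).*2)%N) ?leq_addl // leq_double.
exists (@tagnat.Rank N (fun=> n) (Ordinal (ltnW lt_i))
          (Ordinal (ltn_pmod k n_gt0))).
rewrite /pair_label val_sig2_Rank tagnat.Rank1K -val_eqE /= partnerE /=.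
by rewrite odd_double lt_i gtn_eqF // doubleK -divn_eq.
Qed.

Lemma pair_label_unpaired : odd N -> (0 < n)%N -> exists s, pair_label s = 0%N.
Proof.
move=> oN n_gt0; have N_gt0 := odd_gt0 oN.
have lt_N : (N.-1 < N)%N by rewrite prednK.
have evN : odd N.-1 = false by move: oN; rewrite -{1}(prednK N_gt0) => /negbTE.
exists (@tagnat.Rank N (fun=> n) (Ordinal lt_N) (Ordinal n_gt0)).
rewrite /pair_label tagnat.Rank1K -val_eqE /= partnerE /=.
by rewrite evN prednK // ltnn eqxx.
Qed.

End PairedBlocks.

(** * The number of distinct eigenvalues *)

Local Open Scope classical_set_scope.
Local Open Scope card_scope.

Theorem mainTheorem3 (R : realType) (N n m : nat) (alpha : nat -> R)
    (hN : (1 <= N)%N) (hn : (1 <= n)%N) (hm : (1 <= m)%N) :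
  (forall A : 'BM[R]_(N, n), sym_posdef A -> block_tridiagonal A ->
     spectrum (precond 1 (-1) m alpha A *m A) #<= `I_(eigen_count N n)) /\
  (exists A : 'BM[R]_(N, n), [/\ sym_posdef A, block_tridiagonal A &
     spectrum (precond 1 (-1) m alpha A *m A) #= `I_(eigen_count N n)]).
Proof.
split=> [A pdA triA|]; first exact: spectrum_precond_le.
pose p := step_poly m alpha.
have p01 : p.[0] != p.[1] by rewrite step_poly0 step_poly1 oner_neq0.
have [u [u0 u_itv u_inj]] := separating_points (N./2 * n) p01.
have pdA := @paired_mx_posdef R N n u u_itv.
have triA := @paired_mx_tridiagonal R N n u.
exists (paired_mx N n u); split=> //.
rewrite card_eq_le spectrum_precond_le //=.
(* label 0 is taken only when N is odd; otherwise the labels start at 1 *)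
pose label k := if odd N then k else k.+1.
have label_inj : injective label by rewrite /label; case: (odd N) => // i j [].
have label_le k : (k < eigen_count N n)%N -> (label k <= N./2 * n)%N.
  by rewrite /label /eigen_count; case: (odd N).
have label_onto k : (k < eigen_count N n)%N ->
    exists s : 'I_(\sum_(i < N) n), pair_label s = label k.
  move=> lt_k; have := label_le k lt_k; rewrite /label.
  case: (boolP (odd N)) => oN; last exact: pair_label_onto.
  by case: k {lt_k} => [_|k]; [exact: pair_label_unpaired|exact: pair_label_onto].
suff /injfunPex[f] : exists2 f : nat -> R[i],
    set_fun `I_(eigen_count N n)
      (spectrum (precond 1 (-1) m alpha (paired_mx N n u) *m paired_mx N n u)) f
    & set_inj `I_(eigen_count N n) f by apply: inj_card_le.
exists (fun k => real_complex R p.[u (label k)]) => [k /= lt_k|i j].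
  by have [s <-] := label_onto k lt_k; apply: spectrum_paired_mx.
rewrite !inE /= => lt_i lt_j /fmorph_inj eq_p.
by apply/label_inj/u_inj; rewrite ?label_le.
Qed.
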